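(* Let $z\in S$, $\theta_0\in\Theta$ and $f:S\to\mathbb{R}$. Let $A_1\subseteq A_2\subseteq A_3\subseteq\cdots$ be finite subsets of $S$ with $z\in A_1$ and $\bigcup_{n\ge 1}A_n=S$. Let $\underline{w}_n(\theta_0,z,f)$ and $\underline{w}_n'(\theta_0,z,f)$ be the truncation approximations associated with $A_n$ (defined in the context). Then: (a) If $w(\theta_0,z,|f|)<\infty$, then $\underline{w}_n(\theta_0,z,f)\to w(\theta_0,z,f)$ as $n\to\infty$. (b) If $$\mathbb{E}_z^{\theta_0}\sum_{j=0}^{\tau(z)-1}|f(X_j)|\sum_{k=0}^{j-1}\frac{|P'(\theta_0,X_k,X_{k+1})|}{P(\theta_0,X_k,X_{k+1})}<\infty,$$ then $\underline{w}_n'(\theta_0,z,f)\to w'(\theta_0,z,f)$ as $n\to\infty$.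
   Context: $S$ is a finite or countably infinite set and $\Theta\subseteq\mathbb{R}$ is an open interval. For each $\theta\in\Theta$, $P(\theta)=(P(\theta,x,y):x,y\in S)$ is a stochastic matrix, and the Markov chain $X=(X_n:n\ge 0)$ with transition matrix $P(\theta)$ is irreducible and recurrent. The entries of $P(\theta)$ are differentiable in $\theta$ at $\theta_0$, and $P'(\theta_0,x,y)$ denotes the derivative of $P(\theta,x,y)$ at $\theta=\theta_0$. $\mathbb{E}^\theta_x$ denotes expectation when $X$ evolves according to $P(\theta)$ and $X_0=x$. Put $\tau(z)=\inf\{n\ge 1: X_n=z\}$, $|f|(x)=|f(x)|$, and $$w(\theta,x,f)=\mathbb{E}^{\theta}_x\sum_{j=0}^{\tau(z)-1}f(X_j).$$ $w'(\theta_0,z,f)$ denotes the derivative of $\theta\mapsto w(\theta,z,f)$ at $\theta_0$. For part (b) it is a standing assumption that the regularity conditions hold under which this derivative exists and is given by $$w'(\theta_0,z,f)=\mathbb{E}_z^{\theta_0}\sum_{j=0}^{\tau(z)-1}f(X_j)\sum_{k=0}^{j-1}\frac{P'(\theta_0,X_k,X_{k+1})}{P(\theta_0,X_k,X_{k+1})}.$$ Truncation approximations: for a finite set $A\subseteq S$ with $z\in A$, let $\kappa=A\setminus\{z\}$, let $P_{1\kappa}(\theta)=(P(\theta,z,y):y\in\kappa)$ (row vector), $P_{\kappa\kappa}(\theta)=(P(\theta,x,y):x,y\in\kappa)$, $f_\kappa=(f(x):x\in\kappa)$ (column vector), and let $P'_{1\kappa}(\theta_0),P'_{\kappa\kappa}(\theta_0)$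 be the corresponding entrywise derivatives. Let $T=\inf\{n\ge 0:X_n\notin A\}$ and $$\underline{w}(\theta,z,f)=\mathbb{E}^\theta_z\sum_{j=0}^{(\tau(z)\wedge T)-1}f(X_j)=f(z)+P_{1\kappa}(\theta)\,\mathcal{I}_{\kappa\kappa}(\theta)\,f_\kappa,\qquad \mathcal{I}_{\kappa\kappa}(\theta)=(I-P_{\kappa\kappa}(\theta))^{-1}=\sum_{n=0}^\infty P_{\kappa\kappa}^n(\theta),$$ (the sum and inverse exist by irreducibility when $A \neq S$ and by irreducibility and recurrence in general), and $$\underline{w}'(\theta_0,z,f)=P'_{1\kappa}(\theta_0)\mathcal{I}_{\kappa\kappa}(\theta_0)f_\kappa+P_{1\kappa}(\theta_0)\mathcal{I}_{\kappa\kappa}(\theta_0)P'_{\kappa\kappa}(\theta_0)\mathcal{I}_{\kappa\kappa}(\theta_0)f_\kappa .$$ $\underline{w}_n(\theta_0,z,f)$ and $\underline{w}_n'(\theta_0,z,f)$ are these quantities for $A=A_n$. *)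

(* Defs.v *)
From HB Require Import structures.
From mathcomp Require Import all_boot all_order all_algebra.
From mathcomp Require Import finmap.
From mathcomp Require Import all_classical all_reals all_analysis.
Import Order.TTheory GRing.Theory Num.Theory.
Import numFieldNormedType.Exports.

Set Implicit Arguments.
Unset Strict Implicit.
Unset Printing Implicit Defensive.

Local Open Scope classical_set_scope.
Local Open Scope ring_scope.
Local Open Scope ereal_scope.

Definition stochastic (R : realType) (S : countType) (P : S -> S -> R) : Prop :=
  (forall x y, (0 <= P x y)%R) /\
  (forall x, \esum_(y in [set: S]) (P x y)%:E = 1).

Section chain.
Context (R : realType) (S : countType) (d : measure_display)
        (Omega : measurableType d) (X : nat -> Omega -> S).

(* [Pr x] is the law under the initial condition [X 0 = x].  The last clause is
   the Markov property with the conditional probability multiplied out. *)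
Definition markov_chain (P : S -> S -> R) (Pr : S -> probability Omega R) : Prop :=
  [/\ forall n y, measurable [set w | X n w = y],
      forall x, Pr x [set w | X 0%N w = x] = 1
    & forall x n (s : nat -> S),
        Pr x [set w | forall i, (i <= n.+1)%N -> X i w = s i] =
        Pr x [set w | forall i, (i <= n)%N -> X i w = s i]
          * (P (s n) (s n.+1))%:E].

Definition irreducible (Pr : S -> probability Omega R) : Prop :=
  forall x y, exists n, 0 < Pr x [set w | X n w = y].

(* Infima are taken in [\bar R], so that [ereal_inf set0 = +oo]. *)
Definition return_time (z : S) (w : Omega) : \bar R :=
  ereal_inf [set n%:R%:E | n in [set n | (1 <= n)%N /\ X n w = z]].

Definition exit_time (A : {fset S}) (w : Omega) : \bar R :=
  ereal_inf [set n%:R%:E | n in [set n | X n w \notin A]].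

Definition recurrent (Pr : S -> probability Omega R) : Prop :=
  forall x, Pr x [set w | return_time x w < +oo] = 1.

(* The sum of [u j] over the natural numbers [j <= t - 1], where [t] is an
   integer or [+oo]. *)
Definition stopped_sum (t : \bar R) (u : nat -> R) : \bar R :=
  \sum_(0 <= j <oo | j%:R%:E < t) (u j)%:E.

Definition cycle_value (Pr : S -> probability Omega R) (z : S) (f : S -> R)
    : \bar R :=
  \int[Pr z]_w stopped_sum (return_time z w) (fun j => f (X j w)).

Definition trunc_value (Pr : S -> probability Omega R) (A : {fset S}) (z : S)
    (f : S -> R) : \bar R :=
  \int[Pr z]_w stopped_sum (mine (return_time z w) (exit_time A w))
                           (fun j => f (X j w)).

(* Transitions with [P x y = 0] have probability zero, so the value given to
   [_ / 0] is irrelevant. *)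
Definition cycle_weighted (Pr : S -> probability Omega R) (P P' : S -> S -> R)
    (z : S) (f : S -> R) : \bar R :=
  \int[Pr z]_w stopped_sum (return_time z w)
    (fun j => f (X j w) *
       \sum_(k < j) (P' (X k w) (X k.+1 w) / P (X k w) (X k.+1 w)))%R.

End chain.

Section truncation.
Context (R : realType) (S : countType).
Local Open Scope fset_scope.
Local Open Scope ring_scope.

Definition entry_row (Q : S -> S -> R) (z : S) (K : {fset S}) : 'rV[R]_#|{: K}| :=
  \row_(j < #|{: K}|) Q z (val (enum_val j)).

Definition block (Q : S -> S -> R) (K : {fset S}) : 'M[R]_#|{: K}| :=
  \matrix_(i < #|{: K}|, j < #|{: K}|) Q (val (enum_val i)) (val (enum_val j)).

Definition restr_col (f : S -> R) (K : {fset S}) : 'cV[R]_#|{: K}| :=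
  \col_(i < #|{: K}|) f (val (enum_val i)).

(* [invmx] returns its argument on singular matrices; for an irreducible
   recurrent chain and a proper subset [K], [1 - block P K] is invertible and its
   inverse is the sum of the powers of [block P K]. *)
Definition potential (P : S -> S -> R) (K : {fset S}) : 'M[R]_#|{: K}| :=
  invmx (1%:M - block P K).

Definition trunc_value_mx (P : S -> S -> R) (A : {fset S}) (z : S)
    (f : S -> R) : R :=
  let K := A `\ z in
  f z + (entry_row P z K *m potential P K *m restr_col f K) 0 0.

Definition trunc_deriv_mx (P P' : S -> S -> R) (A : {fset S}) (z : S)
    (f : S -> R) : R :=
  let K := A `\ z in
  (entry_row P' z K *m potential P K *m restr_col f K
     + entry_row P z K *m potential P K *m block P' K *m potential P K
         *m restr_col f K) 0 0.

End truncation.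

(* Main.v *)
(* Write tau for the return time to z, T_n for the exit time of A_n, and
   u_j = f(X_j), resp. u_j = f(X_j) * \sum_(k < j) P'(X_k, X_{k+1}) / P(X_k, X_{k+1}).
   As tau < oo almost surely, tau /\ T_n = tau for all large n, so dominated
   convergence takes the expected sum of the u_j up to tau /\ T_n to the expected
   sum up to tau.  The matrix formula for the stopped expectation at fixed n comes
   from a second dominated convergence, over truncations of the sum at j < m: by the
   Markov property the truncated expectation is a sum of matrix products along
   paths in A_n \ {z}, where P' replaces P at one step (P * (P' / P) = P', since
   P' = 0 where P = 0), and as m grows this is a Neumann series, resp. the Cauchy
   product of two.  By irreducibility and a maximum principle 1 - B is invertible,
   where B is the block of P; the partial sums (1 - B)^-1 (1 - B^m) of the Neumann
   series are then monotone and bounded, so B^m -> 0 and they tend to (1 - B)^-1. *)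
Require Import Defs.
From HB Require Import structures.
From mathcomp Require Import all_boot all_order all_algebra.
From mathcomp Require Import finmap.
From mathcomp Require Import all_classical all_reals all_analysis measurable_realfun.
From mathcomp Require Import zify ring lra.
Import Order.TTheory GRing.Theory Num.Theory.
Import numFieldNormedType.Exports.
Local Open Scope classical_set_scope.
Local Open Scope ring_scope.
Local Open Scope ereal_scope.
Set Implicit Arguments.
Unset Strict Implicit.
Unset Printing Implicit Defensive.

(** * Neumann series of substochastic matrices and their Cauchy products *)

Section neumann.
Local Open Scope ring_scope.
Variable R : realType.

Lemma cvgr_sum (I : Type) (r : seq I) (u : I -> nat -> R) (l : I -> R) :
  (forall i, u i n @[n --> \oo] --> l i) ->
  (\sum_(i <- r) u i n) @[n --> \oo] --> \sum_(i <- r) l i.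
Proof.
move=> ul; elim: r => [|i r IHr].
  by rewrite big_nil; under eq_fun do rewrite big_nil; exact: cvg_cst.
rewrite big_cons; under eq_fun do rewrite big_cons; exact: cvgD.
Qed.

Lemma cvg_mxM (m n p : nat) (U : nat -> 'M[R]_(m, n)) (L : 'M[R]_(m, n))
    (V : nat -> 'M[R]_(n, p)) (M : 'M[R]_(n, p)) :
  (forall i j, U k i j @[k --> \oo] --> L i j) ->
  (forall i j, V k i j @[k --> \oo] --> M i j) ->
  forall i j, (U k *m V k) i j @[k --> \oo] --> (L *m M) i j.
Proof.
move=> UL VM i j; rewrite mxE; under eq_fun do rewrite mxE.
by apply: cvgr_sum => k; exact: cvgM.
Qed.

(** The index pairs of total less than [n] form a triangle that contains the square of side [n./2]
    and lies in the square of side [n]. As all terms are nonnegative, the two products of partial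
    sums squeeze the sum. *)
Lemma series_cauchy_product (x y : nat -> R) (a b : R) :
  (forall n, 0 <= x n) -> (forall n, 0 <= y n) ->
  (\sum_(k < n) x k) @[n --> \oo] --> a ->
  (\sum_(k < n) y k) @[n --> \oo] --> b ->
  (\sum_(j < n) \sum_(k < j.+1) x k * y (j - k)%N) @[n --> \oo] --> a * b.
Proof.
move=> x0 y0 xa yb.
have xD n : \sum_(j < n) \sum_(k < j.+1) x k * y (j - k)%N =
    \sum_(k < n) x k * \sum_(j < n - k) y j.
  elim: n => [|n IHn]; first by rewrite !big_ord0.
  rewrite big_ord_recr/= IHn [RHS]big_ord_recr/= [in LHS]big_ord_recr/= addrA.
  rewrite subnn -[n.+1]addn1 addKn big_ord1; congr (_ + _).
  rewrite -big_split/=; apply: eq_bigr => k _.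
  by rewrite addn1 subSn ?(ltnW (ltn_ord _))// big_ord_recr/= mulrDr.
have y_mono n m : (n <= m)%N -> \sum_(j < n) y j <= \sum_(j < m) y j.
  move=> nm; rewrite -!(big_mkord xpredT) (big_cat_nat (leq0n n) nm)/=.
  by rewrite lerDl sumr_ge0.
have half : (fun n : nat => n./2) @ \oo --> \oo.
  apply/cvgnyPge => M; exists M.*2 => // n /= Mn.
  by rewrite -(doubleK M) half_leq.
apply: (@squeeze_cvgr _ _ _ _
  (fun n => (\sum_(k < n./2) x k) * (\sum_(k < n./2) y k))
  (fun n => (\sum_(k < n) x k) * (\sum_(k < n) y k))).
- near=> n; rewrite xD; apply/andP; split.
    have hn : (n./2 <= n)%N by lia.
    rewrite -[leRHS](big_mkord xpredT (fun k => x k * \sum_(j < n - k) y j)).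
    rewrite (big_cat_nat (leq0n _) hn)/= big_mkord mulr_suml.
    rewrite -[leLHS]addr0 lerD//; last first.
      by rewrite sumr_ge0// => k _; rewrite mulr_ge0// sumr_ge0.
    apply: ler_sum => k _; apply: ler_wpM2l => //; apply: y_mono.
    by have := ltn_ord k; lia.
  rewrite mulr_suml; apply: ler_sum => k _; apply: ler_wpM2l => //.
  by apply: y_mono; lia.
- by apply: cvgM; [apply: (cvg_comp _ _ half xa) | apply: (cvg_comp _ _ half yb)].
- exact: cvgM.
Unshelve. all: by end_near. Qed.

Section powers.
Variables (m : nat) (B : 'M[R]_m).
Hypothesis B0 : forall i j, 0 <= B i j.
Hypothesis B1 : forall i, \sum_j B i j <= 1.
Hypothesis unitB : 1%:M - B \in unitmx.
Let N := invmx (1%:M - B).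

Lemma mxpow_ge0 n i j : 0 <= (B ^+ n) i j.
Proof.
elim: n i j => [|n IHn] i j; first by rewrite expr0 !mxE ler0n.
by rewrite exprS !mxE sumr_ge0// => k _; rewrite mulr_ge0.
Qed.

Lemma mxpow_row_le1 n i : \sum_j (B ^+ n) i j <= 1.
Proof.
elim: n i => [|n IHn] i.
  rewrite expr0 (bigD1 i)//= big1 ?mxE ?eqxx ?addr0// => j ji.
  by rewrite mxE eq_sym (negbTE ji).
rewrite exprS; under eq_bigr do rewrite mxE.
rewrite exchange_big/=; apply: le_trans (B1 i); apply: ler_sum => k _.
by rewrite -mulr_sumr ler_piMr.
Qed.

Lemma mxpow_le1 n i j : (B ^+ n) i j <= 1.
Proof.
apply: le_trans (mxpow_row_le1 n i); rewrite (bigD1 j)//= lerDl sumr_ge0// => k _.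
exact: mxpow_ge0.
Qed.

Lemma mxgeom_sum n : \sum_(k < n) B ^+ k = N *m (1%:M - B ^+ n).
Proof.
apply: (can_inj (mulKmx unitB)); rewrite mulKVmx//.
elim: n => [|n IHn]; first by rewrite big_ord0 mulmx0 expr0 subrr.
rewrite big_ord_recr/= mulmxDr IHn mulmxBl mul1mx exprS.
by rewrite addrA subrK.
Qed.

Lemma mxgeom_cvg i j : (\sum_(k < n) (B ^+ k) i j) @[n --> \oo] --> N i j.
Proof.
have S n i' j' : \sum_(k < n) (B ^+ k) i' j' = (N *m (1%:M - B ^+ n)) i' j'.
  by rewrite -mxgeom_sum summxE.
have B_0 i' j' : (B ^+ n) i' j' @[n --> \oo] --> 0.
  apply: cvg_series_cvg_0; apply: nondecreasing_is_cvgn.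
    apply/nondecreasing_seqP => n; rewrite /series/= big_nat_recr//= lerDl.
    exact: mxpow_ge0.
  (* The entries of [1 - B ^+ n] lie in [-1, 1], so the absolute row sum of [N] bounds every partial
     sum. *)
  exists (\sum_k `|N i' k|) => _ [n _ <-]; rewrite /series/= big_mkord S mxE.
  apply: ler_sum => k _; rewrite (le_trans (ler_norm _))// normrM.
  rewrite ler_piMr// !mxE ler_norml.
  have := mxpow_ge0 n k j'; have := mxpow_le1 n k j'.
  by case: (k == j') => /= ? ?; apply/andP; split; lra.
have -> : N i j = (N *m (1%:M - 0)) i j by rewrite subr0 mulmx1.
rewrite (funext (fun n => S n i j)); apply: cvg_mxM => [k l|k l].
  exact: cvg_cst.
have -> : (fun n => (1%:M - B ^+ n) k l) = (fun n => 1%:M k l - (B ^+ n) k l).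
  by apply/funext => n; rewrite !mxE.
have -> : (1%:M - 0 : 'M[R]_m) k l = 1%:M k l - 0 by rewrite !mxE.
by apply: cvgB; [exact: cvg_cst|exact: B_0].
Qed.

(** Entrywise this is a finite combination, with coefficients [Q a b], of scalar Cauchy products of
    powers of [B]. Only those powers have to be nonnegative, so [Q] may have any sign, as a
    derivative does. *)
Lemma mxcauchy_cvg (Q : 'M[R]_m) i j :
  (\sum_(l < n) \sum_(k < l.+1) (B ^+ k *m Q *m B ^+ (l - k)) i j) @[n --> \oo]
  --> (N *m Q *m N) i j.
Proof.
have E (U V : 'M[R]_m) : (U *m Q *m V) i j = \sum_b \sum_a Q a b * (U i a * V b j).
  rewrite mxE; apply: eq_bigr => b _; rewrite mxE mulr_suml.
  by apply: eq_bigr => a _; rewrite mulrAC mulrC.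
rewrite E; under eq_fun.
  move=> n; under eq_bigr do under eq_bigr do rewrite E.
  under eq_bigr do rewrite exchange_big/=.
  rewrite exchange_big/=.
  under eq_bigr do under eq_bigr do rewrite exchange_big/=.
  under eq_bigr do rewrite exchange_big/=.
  under eq_bigr do under eq_bigr do under eq_bigr do rewrite -mulr_sumr.
  under eq_bigr do under eq_bigr do rewrite -mulr_sumr.
  over.
apply: cvgr_sum => b; apply: cvgr_sum => a; apply: cvgM; first exact: cvg_cst.
apply: (@series_cauchy_product (fun k => (B ^+ k) i a) (fun k => (B ^+ k) b j)).
- by move=> n; exact: mxpow_ge0.
- by move=> n; exact: mxpow_ge0.
- exact: mxgeom_cvg.
- exact: mxgeom_cvg.
Qed.

End powers.
End neumann.

(** * Finite blocks of a stochastic kernel and invertibility of [1 - B] *)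

Section kernel.
Local Open Scope ring_scope.
Variables (R : realType) (S : countType) (P : S -> S -> R).
Hypothesis P_stoch : stochastic P.

Lemma stochastic_sum_le1 (x : S) (r : seq S) : uniq r -> \sum_(y <- r) P x y <= 1.
Proof.
move=> r_uniq; rewrite -lee_fin -(P_stoch.2 x) -sumEFin fsbig_seq//.
by apply: esum_ge; exists [set` r]; first by split; first exact: finite_seq.
Qed.

Definition fset_elt (K : {fset S}) (i : 'I_#|{: K}|) : S := val (enum_val i).

Lemma fset_elt_in (K : {fset S}) (i : 'I_#|{: K}|) : fset_elt i \in K.
Proof. exact: valP. Qed.

Lemma fset_eltP (K : {fset S}) x : x \in K -> exists i : 'I_#|{: K}|, x = fset_elt i.
Proof.
move=> xK; exists (enum_rank [` xK]%fset).
by rewrite /fset_elt enum_rankK.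
Qed.

Lemma sum_fset_elt (K : {fset S}) (F : S -> R) :
  \sum_(y <- K) F y = \sum_(i < #|{: K}|) F (fset_elt i).
Proof. by rewrite big_seq_fsetE (reindex _ (onW_bij _ (@enum_val_bij K))). Qed.

Lemma block_ge0 (K : {fset S}) i j : 0 <= block P K i j.
Proof. by rewrite mxE P_stoch.1. Qed.

Lemma block_row_le1 (K : {fset S}) i : \sum_j block P K i j <= 1.
Proof.
have := @stochastic_sum_le1 (fset_elt i) K (fset_uniq K).
by rewrite sum_fset_elt; under [in X in _ -> X]eq_bigr do rewrite mxE.
Qed.

(* Maximum principle: the set where a vector fixed by the block attains its
   maximal modulus is closed under the transitions of [P], so [z] is out of reach. *)
Lemma block_unitmx (K : {fset S}) (z : S) : z \notin K ->
  (forall x, exists n (s : nat -> S), [/\ s 0%N = x, s n = z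
     & forall i, (i < n)%N -> 0 < P (s i) (s i.+1)]) ->
  1%:M - block P K \in unitmx.
Proof.
(* [det0P] yields a left null vector; transposing first makes it a right one, so that [v] is fixed
   by the block. *)
move=> zK reach; rewrite unitmxE unitfE -det_tr; apply/negP => /det0P[v v0 vE].
have vP i : v 0 i = \sum_(j < #|{: K}|) P (fset_elt i) (fset_elt j) * v 0 j.
  have /matrixP/(_ 0 i) := vE.
  rewrite linearB/= trmx1 mulmxBr mulmx1 mxE [in X in _ + X]mxE [RHS]mxE.
  move=> /subr0_eq ->; rewrite mxE; apply: eq_bigr => j _.
  by rewrite !mxE mulrC.
have [i0 vi0] : exists i, v 0 i != 0.
  apply/existsP; rewrite -negb_forall; apply: contra v0 => /forallP v0.
  by apply/eqP/rowP => i; rewrite mxE; apply/eqP.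
have [i _ max_i] := @arg_maxP _ _ _ i0 xpredT (fun j => `|v 0 j|) isT.
have {max_i} [M vi max_i] : exists2 M : R, `|v 0 i| = M & forall k, `|v 0 k| <= M.
  by exists `|v 0 i| => // k; exact: max_i.
have M0 : 0 < M by rewrite (lt_le_trans _ (max_i i0))// normr_gt0.
have closed j y : `|v 0 j| = M -> 0 < P (fset_elt j) y ->
    exists2 k, y = fset_elt k & `|v 0 k| = M.
  move=> vj Pjy.
  have MP : M <= \sum_k P (fset_elt j) (fset_elt k) * `|v 0 k|.
    rewrite -vj {1}vP (le_trans (ler_norm_sum _ _ _))// ler_sum// => k _.
    by rewrite normrM (ger0_norm (P_stoch.1 _ _)).
  have term k : 0 <= P (fset_elt j) (fset_elt k) * (M - `|v 0 k|).
    by rewrite mulr_ge0 ?P_stoch.1// subr_ge0 max_i.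
  (* The left side is nonnegative and the right side nonpositive, so both vanish: every state of [K]
     reached from [j] attains the maximum, and the row sum over [K] is 1, which leaves no mass for a
     [y] outside [K]. *)
  have MPle : \sum_k P (fset_elt j) (fset_elt k) * (M - `|v 0 k|) <=
      M * (\sum_(k < #|{: K}|) P (fset_elt j) (fset_elt k) - 1).
    rewrite mulrBr mulr1 (eq_bigr _ (fun k _ => mulrBr _ _ _)) sumrB -mulr_suml.
    by rewrite mulrC lerB.
  have [yK|yK] := boolP (y \in K).
    have [k yk] := fset_eltP yK; exists k => //.
    have : \sum_k P (fset_elt j) (fset_elt k) * (M - `|v 0 k|) = 0.
      apply/eqP; rewrite eq_le sumr_ge0 ?andbT//; apply: le_trans MPle _.
      rewrite mulr_ge0_le0 ?(ltW M0)// subr_le0.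
      by rewrite -(sum_fset_elt K (P (fset_elt j))) (stochastic_sum_le1 _ (fset_uniq K)).
    move=> /(psumr_eq0P (fun i _ => term i)) /(_ k isT) /eqP.
    rewrite mulf_eq0 -yk gt_eqF//= subr_eq0 => /eqP ->//.
  have := @stochastic_sum_le1 (fset_elt j) (y :: K).
  rewrite /= yK fset_uniq => /(_ isT); rewrite big_cons sum_fset_elt => Ple1.
  have : 0 <= M * (\sum_(k < #|{: K}|) P (fset_elt j) (fset_elt k) - 1).
    by apply: le_trans MPle; rewrite sumr_ge0.
  by rewrite pmulr_rge0// subr_ge0 => ge1;
    move: (lt_le_trans (ltr_pwDl Pjy ge1) Ple1); rewrite ltxx.
have [n [s [s0 sn sP]]] := reach (fset_elt i).
have : exists2 k, s n = fset_elt k & `|v 0 k| = M.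
  elim: {-2}n (leqnn n) => [_|l IHl ln]; first by exists i.
  have [k sk vk] := IHl (ltnW ln).
  by apply: closed vk _; rewrite -sk sP.
by rewrite sn => -[k zk _]; move: zK; rewrite zk fset_elt_in.
Qed.
End kernel.

(** * Stopped sums: measurability and dominated convergence *)

Section measurability.
Context (R : realType) (d : measure_display) (Omega : measurableType d).

(** Tail infima and tail suprema squeeze the sequence, and the hypothesis makes their limits
    coincide. *)
Lemma cvgn_limn_esup_le_einf (u : nat -> \bar R) :
  limn_esup u <= limn_einf u -> u @ \oo --> limn_esup u.
Proof.
move=> le_u; have eq_u : limn_einf u = limn_esup u.
  apply/eqP; rewrite eq_le limn_einf_sup; exact: le_u.
apply: (@squeeze_cvge _ _ _ _ (einfs u) _ (esups u)).
- apply: nearW => n; apply/andP; split.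
    by apply: ereal_inf_lbound; exists n => /=.
  by apply: ereal_sup_ubound; exists n => /=.
- rewrite -eq_u limn_einf_lim; exact: is_cvg_einfs.
- rewrite limn_esup_lim; exact: is_cvg_esups.
Qed.

(* Where the sequence diverges, [limn] is the constant [point]. *)
Lemma measurable_limn (f : nat -> Omega -> \bar R) :
  (forall n, measurable_fun setT (f n)) ->
  measurable_fun setT (fun x => limn (f ^~ x)).
Proof.
move=> mf.
have mes := measurable_fun_limn_esup mf.
have mei : measurable_fun setT (fun x => limn_einf (f ^~ x)).
  rewrite (_ : (fun x => _) = (fun x => - limn_esup (fun n => - f n x))).
    apply: measurableT_comp => //; apply: measurable_fun_limn_esup => n.
    exact: measurableT_comp.
  by apply/funext => x; rewrite limn_esupN oppeK.
rewrite (_ : (fun x => _) = (fun x =>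
  if limn_esup (f ^~ x) <= limn_einf (f ^~ x) then limn_esup (f ^~ x) else point)).
  apply: measurable_fun_ifT => //; exact: measurable_fun_lee.
apply/funext => x; case: ifPn => [/cvgn_limn_esup_le_einf/cvg_lim -> //|].
move=> nle; apply: dvgP; apply: contraNnot nle => /cvg_ex[l /cvg_limn_einf_sup[]].
by move=> -> ->.
Qed.

(** The state space carries no sigma-algebra; a preimage is a countable union of fibres of [Y],
    whatever [g] is. *)
Lemma measurable_countable_comp (T : countType) (Y : Omega -> T) d'
    (U : measurableType d') (g : T -> U) :
  (forall y, measurable [set w | Y w = y]) ->
  measurable_fun setT (fun w => g (Y w)).
Proof.
move=> mY _ B mB; rewrite setTI.
rewrite (_ : _ @^-1` B = \bigcup_(y in [set: T]) 
  (if g y \in B then [set w | Y w = y] else set0)).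
  apply: countable_bigcupT_measurable => [|y]; first exact: countableP.
  by case: ifP.
apply/seteqP; split=> [w /= gYB|w [y _]]; first by exists (Y w) => //=; rewrite mem_set.
by case: ifPn => // /set_mem gB /= ->.
Qed.

(** Both [return_time] and [exit_time] are instances, and are treated together through it. *)
Definition first_time (Q : nat -> Prop) : \bar R :=
  ereal_inf [set n%:R%:E | n in [set n | Q n]].

Lemma lt_first_time (Q : nat -> Prop) (j : nat) :
  (j%:R%:E < first_time Q) <-> (forall n, Q n -> (j < n)%N).
Proof.
split=> [jQ n Qn|jQ].
  have : first_time Q <= n%:R%:E by apply: ereal_inf_lbound; exists n.
  by move/(lt_le_trans jQ); rewrite lte_fin ltr_nat.
apply: (@lt_le_trans _ _ j.+1%:R%:E); first by rewrite lte_fin ltr_nat.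
by apply: le_ereal_inf_tmp => _ [n Qn <-]; rewrite lee_fin ler_nat jQ.
Qed.

Lemma measurable_lt_first_time (Q : nat -> Omega -> Prop) (j : nat) :
  (forall n, measurable [set w | Q n w]) ->
  measurable_fun setT (fun w => j%:R%:E < first_time (Q ^~ w)).
Proof.
move=> mQ; apply: (measurable_fun_bool true); rewrite setTI.
rewrite (_ : _ @^-1` _ = \bigcap_(n in [set n | (n <= j)%N]) ~` [set w | Q n w]).
  by apply: bigcap_measurableType => n _; exact: measurableC.
apply/seteqP; split=> w /=.
  move=> /lt_first_time jQ n /= nj Qn; have := jQ n Qn.
  by rewrite ltnNge nj.
move=> jQ; apply/lt_first_time => n Qn; rewrite ltnNge; apply/negP => nj.
exact: jQ Qn.
Qed.

Lemma stopped_sum_fin (t : \bar R) (u : nat -> R) (m n : nat) :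
  t <= m%:R%:E -> (m <= n)%N ->
  \sum_(0 <= j < n | (j%:R%:E < t)%E) (u j)%:E =
  \sum_(0 <= j < m | (j%:R%:E < t)%E) (u j)%:E.
Proof.
move=> tm mn; rewrite (big_cat_nat (leq0n m) mn)/= [X in _ + X]big1_seq ?adde0// => j.
rewrite mem_index_iota => /andP[jt /andP[mj _]].
by move: (lt_le_trans jt tm); rewrite lte_fin ltr_nat ltnNge mj.
Qed.

(** The partial sums are constant from [m] on, so the defining limit exists for terms of any
    sign. *)
Lemma stopped_sumE (t : \bar R) (u : nat -> R) (m : nat) : t <= m%:R%:E ->
  stopped_sum t u = \sum_(0 <= j < m | (j%:R%:E < t)%E) (u j)%:E.
Proof.
move=> tm; apply: lim_near_cst => //.
by exists m => // n /= mn; exact: stopped_sum_fin.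
Qed.

Lemma lty_le_nat (t : \bar R) : t < +oo -> exists m, t <= m%:R%:E.
Proof.
case: t => [r| |]// _; last by exists 0%N; rewrite leNye.
exists (Num.truncn r).+1; rewrite lee_fin; exact/ltW/truncnS_gt.
Qed.

Lemma cvg_stopped_sum (t : \bar R) (u : nat -> R) : t < +oo ->
  \sum_(0 <= j < n | (j%:R%:E < t)%E) (u j)%:E @[n --> \oo] --> stopped_sum t u.
Proof.
move=> /lty_le_nat[m tm]; rewrite (stopped_sumE _ tm); apply: cvg_near_cst.
by exists m => // n /= mn; exact: stopped_sum_fin.
Qed.

(** The bound depends neither on [n] nor on [s], hence can serve as a dominating function. *)
Lemma abse_stopped_le (s t : \bar R) (u : nat -> R) (n : nat) : s <= t -> t < +oo ->
  `|\sum_(0 <= j < n | (j%:R%:E < s)%E) (u j)%:E| <= stopped_sum t (fun j => `|u j|%R).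
Proof.
move=> st tfin; apply: le_trans (lee_abs_sum _ _ _) _.
apply: le_trans (nneseries_lim_ge _ _); last by move=> k _ _; rewrite lee_fin.
rewrite big_mkcond [leRHS]big_mkcond; apply: lee_sum => j _.
case: ifPn => [js|_]; first by rewrite (lt_le_trans js st).
by case: ifP => _ //; rewrite lee_fin.
Qed.

Lemma abse_stopped_sum_le (s t : \bar R) (u : nat -> R) : s <= t -> t < +oo ->
  `|stopped_sum s u| <= stopped_sum t (fun j => `|u j|%R).
Proof.
move=> st tfin; have [m tm] := lty_le_nat tfin.
by rewrite (stopped_sumE _ (le_trans st tm)); exact: abse_stopped_le.
Qed.

Section stopped.
Variables (t : Omega -> \bar R) (u : nat -> Omega -> R).
Hypothesis mt : forall j : nat, measurable_fun setT (fun w => j%:R%:E < t w).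
Hypothesis mu : forall j, measurable_fun setT (u j).

Lemma measurable_stopped_psum n : measurable_fun setT
  (fun w => \sum_(0 <= j < n | (j%:R%:E < t w)%E) (u j w)%:E).
Proof.
under eq_fun do rewrite big_mkcond.
apply: emeasurable_sum => j; apply: measurable_fun_ifT => //.
exact/measurable_EFinP.
Qed.

Lemma measurable_stopped_sum : measurable_fun setT
  (fun w => stopped_sum (t w) (u ^~ w)).
Proof. by apply: measurable_limn => n; exact: measurable_stopped_psum. Qed.

End stopped.

Section dominated.
Variables (P : probability Omega R) (tau : Omega -> \bar R) (u : nat -> Omega -> R).
Hypothesis mtau : forall j : nat, measurable_fun setT (fun w => j%:R%:E < tau w).
Hypothesis mu : forall j, measurable_fun setT (u j).
Hypothesis tau_fin : \forall w \ae P, tau w < +oo.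
Hypothesis dom : \int[P]_w stopped_sum (tau w) (fun j => `|u j w|%R) < +oo.

Lemma integrable_stopped_abs : P.-integrable setT
  (fun w => stopped_sum (tau w) (fun j => `|u j w|%R)).
Proof.
apply/integrableP; split.
  by apply: measurable_stopped_sum => // j; exact: measurableT_comp.
apply: le_lt_trans dom; rewrite le_eqVlt; apply/orP; left; apply/eqP.
by apply: eq_integral => w _; rewrite gee0_abs// nneseries_ge0//.
Qed.

(** Applied at a fixed finite set, with [t] the truncated return time, to compute the stopped
    expectation. *)
Lemma cvg_integral_stopped_psum (t : Omega -> \bar R) :
  (forall j : nat, measurable_fun setT (fun w => j%:R%:E < t w)) ->
  (forall w, t w <= tau w) ->
  \int[P]_w (\sum_(0 <= j < n | (j%:R%:E < t w)%E) (u j w)%:E) @[n --> \oo]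
  --> \int[P]_w stopped_sum (t w) (u ^~ w).
Proof.
move=> mt t_le.
have [] // := @dominated_convergence _ _ _ P setT measurableT
  (fun n w => \sum_(0 <= j < n | (j%:R%:E < t w)%E) (u j w)%:E)
  (fun w => stopped_sum (t w) (u ^~ w)) _ _ _ _ integrable_stopped_abs _.
- by move=> n; exact: measurable_stopped_psum.
- exact: measurable_stopped_sum.
- apply: filterS tau_fin => w tw _; apply: cvg_stopped_sum.
  exact: le_lt_trans (t_le w) tw.
- by apply: filterS tau_fin => w tw n _; exact: abse_stopped_le.
Qed.

(** Applied along the growing sets; almost surely the integrand is eventually equal to its limit. *)
Lemma cvg_integral_stopped_sum (t : nat -> Omega -> \bar R) :
  (forall k (j : nat), measurable_fun setT (fun w => j%:R%:E < t k w)) ->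
  (forall k w, t k w <= tau w) ->
  (forall w, tau w < +oo -> \forall k \near \oo, t k w = tau w) ->
  \int[P]_w stopped_sum (t k w) (u ^~ w) @[k --> \oo]
  --> \int[P]_w stopped_sum (tau w) (u ^~ w).
Proof.
move=> mt t_le t_eq.
have [] // := @dominated_convergence _ _ _ P setT measurableT
  (fun k w => stopped_sum (t k w) (u ^~ w))
  (fun w => stopped_sum (tau w) (u ^~ w)) _ _ _ _ integrable_stopped_abs _.
- by move=> k; exact: measurable_stopped_sum.
- exact: measurable_stopped_sum.
- apply: filterS tau_fin => w tw _; apply: cvg_near_cst.
  by apply: filterS (t_eq w tw) => k ->.
- by apply: filterS tau_fin => w tw n _; exact: abse_stopped_sum_le.
Qed.

End dominated.
End measurability.

(** * Path probabilities and path expectations of the chain *)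

Section markov.
Context (R : realType) (S : countType) (d : measure_display)
        (Omega : measurableType d) (X : nat -> Omega -> S).
Variables (P : S -> S -> R) (Pr : S -> probability Omega R).
Hypothesis P_stoch : stochastic P.
Hypothesis X_markov : markov_chain X P Pr.

Lemma ae_probability1 (mu : probability Omega R) (E : set Omega) :
  measurable E -> mu E = 1 -> \forall w \ae mu, E w.
Proof.
move=> mE E1; exists (~` E); split => //; first exact: measurableC.
by rewrite probability_setC// E1 subee.
Qed.

Lemma measurable_state n y : measurable [set w | X n w = y].
Proof. by have [] := X_markov. Qed.

Lemma measurable_state_comp d' (U : measurableType d') (g : S -> U) n :
  measurable_fun setT (fun w => g (X n w)).
Proof. by apply: measurable_countable_comp => y; exact: measurable_state. Qed.

Lemma measurable_step_comp d' (U : measurableType d') (r : S -> S -> U) n :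
  measurable_fun setT (fun w => r (X n w) (X n.+1 w)).
Proof.
apply: (@measurable_countable_comp _ _ _ (fun w => (X n w, X n.+1 w)) _ _
  (fun p => r p.1 p.2)) => -[x y].
rewrite (_ : [set w | _] = [set w | X n w = x] `&` [set w | X n.+1 w = y]).
  by apply: measurableI; exact: measurable_state.
by apply/seteqP; split=> w /=; [move=> [-> ->]|move=> [-> ->]].
Qed.

Lemma ae_start x : \forall w \ae Pr x, X 0%N w = x.
Proof.
apply: ae_probability1; first exact: measurable_state.
by have [] := X_markov.
Qed.

Definition cylinder (s : nat -> S) n := [set w | forall i, (i <= n)%N -> X i w = s i].

Lemma measurable_cylinder s n : measurable (cylinder s n).
Proof.
rewrite (_ : cylinder s n = \bigcap_(i in [set i | (i <= n)%N]) [set w | X i w = s i]).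
  by apply: bigcap_measurableType => i _; exact: measurable_state.
by apply/seteqP; split.
Qed.

(** The Markov property factors the probability of a cylinder step by step, so positivity passes to
    every factor; a wrong starting state would put the cylinder inside a null event. *)
Lemma cylinder_pos x s n : 0 < Pr x (cylinder s n) ->
  s 0%N = x /\ forall i, (i < n)%N -> (0 < P (s i) (s i.+1))%R.
Proof.
have [_ start step] := X_markov.
elim: n => [|n IHn] s_gt0.
  split=> //; apply/eqP; apply: contraPT s_gt0 => sx.
  have sub : cylinder s 0 `<=` ~` [set w | X 0%N w = x].
    by move=> w /(_ 0%N isT) /= -> /eqP; apply/negP.
  rewrite (subset_measure0 _ _ sub) ?ltxx//; first exact: measurable_cylinder.
    exact/measurableC/measurable_state.
  by rewrite [LHS]probability_setC ?start ?subee//; exact: measurable_state.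
move: s_gt0; rewrite /cylinder step mule_ge0_gt0 ?lee_fin ?P_stoch.1// lte_fin.
move=> /andP[/IHn [s0 sP] Pn]; split=> // i.
by rewrite ltnS leq_eqVlt => /predU1P[->//|/sP].
Qed.

(** The event [X n = y] is covered by countably many cylinders. Without a path of positive
    transitions each of them would be null, and so would the event. *)
Lemma irreducible_path : irreducible X Pr -> forall x y, exists n (s : nat -> S),
  [/\ s 0%N = x, s n = y & forall i, (i < n)%N -> (0 < P (s i) (s i.+1))%R].
Proof.
move=> X_irr x y; have [n Xn] := X_irr x y; apply: contrapT => no_path.
have : (Pr x).-negligible [set w | X n w = y].
  (* Finite words of states enumerate the cylinders; [y] pads a word that is too short. *)
  pose F (k : nat) := if @choice.unpickle (seq S : countType) k is Some l then
    [set w | X n w = y] `&` cylinder (nth y l) n else set0.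
  apply: (@negligibleS _ _ _ _ (\bigcup_k F k)).
    move=> w /= Xnw; exists (choice.pickle (mkseq (X ^~ w) n.+1)) => //.
    rewrite /F choice.pickleK; split => // i ile; by rewrite nth_mkseq.
  apply: negligible_bigcup => k; rewrite /F.
  case: (choice.unpickle k) => [l|]; last exact: negligible_set0.
  have [ly|ly] := eqVneq (nth y l n) y; last first.
    rewrite (_ : _ `&` _ = set0); first exact: negligible_set0.
    apply/seteqP; split => // w [/= Xnw /(_ n (leqnn n))].
    by rewrite Xnw => /esym/eqP; rewrite (negbTE ly).
  apply: (@negligibleS _ _ _ _ (cylinder (nth y l) n)); first by move=> w [].
  apply/negligibleP; first exact: measurable_cylinder.
  apply: contrapT => /eqP ne0; apply: no_path; exists n, (nth y l).
  have : 0 < Pr x (cylinder (nth y l) n) by rewrite lt0e ne0 measure_ge0.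
  by move=> /cylinder_pos[].
move=> /(negligibleP _ (measurable_state n y)) X0.
by move: Xn; rewrite X0 ltxx.
Qed.

Section path.
Variables (K : {fset S}) (g : S -> R).

(* Weight of the trajectory started at time [n] on the event that it stays in
   [K] at times [n + 1, ..., n + size rs]. *)
Fixpoint path_weight (rs : seq (S -> S -> R)) (n : nat) (w : Omega) : R :=
  if rs is r :: rs' then
    ((X n.+1 w \in K)%:R * r (X n w) (X n.+1 w) * path_weight rs' n.+1 w)%R
  else g (X n w).

(** The conditional expectation of [path_weight] given the present state [x], when each kernel in
    [Ms] is [P] times the weight of that step. *)
Fixpoint path_value (Ms : seq (S -> S -> R)) (x : S) : R :=
  if Ms is M :: Ms' then (\sum_(y <- K) M x y * path_value Ms' y)%R else g x.

Lemma path_weightE rs n w : path_weight rs n w =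
  ((all (fun i => X i w \in K) (iota n.+1 (size rs)))%:R
   * \prod_(i < size rs) nth (fun _ _ => 1%R) rs i (X (n + i) w) (X (n + i).+1 w)
   * g (X (n + size rs) w))%R.
Proof.
elim: rs n => [|r rs IHrs] n /=; first by rewrite big_ord0 !mul1r addn0.
rewrite IHrs big_ord_recl/= addn0 -addSnnS -mulnb natrM [in RHS](eq_bigr
  (fun i : 'I_(size rs) => 
    nth (fun _ _ => 1%R) rs i (X (n.+1 + i) w) (X (n.+1 + i).+1 w))).
  by ring.
by move=> i _; rewrite /bump/= add1n addnS.
Qed.

Lemma sum_fset_delta (x : S) (F : S -> R) :
  (\sum_(y <- K) (x == y)%:R * F y = (x \in K)%:R * F x)%R.
Proof.
have [xK|xK] := boolP (x \in K).
  rewrite (bigD1_seq x) ?fset_uniq//= eqxx mul1r big1 ?addr0// => y yx.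
  by rewrite eq_sym (negbTE yx) mul0r.
rewrite mul0r big1_seq// => y /andP[_ yK].
by case: eqP yK xK => [->->//|]; rewrite mul0r.
Qed.

(** Induction on the remaining steps, with the past recorded by a cylinder. Splitting on the next
    state refines the cylinder by one step and multiplies its probability by an entry of [P].
    Integrability is carried along because linearity of the integral requires it. *)
Lemma integral_path_cylinder x rs (s : nat -> S) n :
  (Pr x).-integrable setT
    (fun w => (\1_(cylinder s n) w * path_weight rs n w)%:E) /\
  \int[Pr x]_w (\1_(cylinder s n) w * path_weight rs n w)%:E =
  Pr x (cylinder s n) *
    (path_value [seq (fun x y => P x y * r x y)%R | r <- rs] (s n))%:E.
Proof.
have [_ _ step] := X_markov.
elim: rs s n => [|r rs IHrs] s n.
  have E w : (\1_(cylinder s n) w * path_weight [::] n w)%:E =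
      (g (s n))%:E * (\1_(cylinder s n) w)%:E.
    rewrite -EFinM mulrC /= indicE.
    have [/set_mem /(_ n (leqnn n)) ->//|_] := boolP (w \in cylinder s n).
    by rewrite !mulr0.
  have mc := measurable_cylinder s n.
  have int1 : (Pr x).-integrable setT (fun w => (\1_(cylinder s n) w)%:E).
    exact: integrable_indic.
  split; first by under eq_fun do rewrite E; exact: integrableZl.
  under eq_integral do rewrite E.
  by rewrite integralZl// integral_indic// setIT muleC.
(* The history [s] up to time [n], continued by [y] at time [n.+1]. *)
pose sy y i := if i == n.+1 then y else s i.
have syn y : cylinder (sy y) n = cylinder s n.
  apply/seteqP; split => w ws i ile; have := ws i ile;
  by rewrite /sy ifN// ltn_eqF.
have E w : (\1_(cylinder s n) w * path_weight (r :: rs) n w)%:E =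
    \sum_(y <- K) (r (s n) y)%:E *
      (\1_(cylinder (sy y) n.+1) w * path_weight rs n.+1 w)%:E.
  under eq_bigr do rewrite -EFinM; rewrite sumEFin; congr EFin.
  have ind y : (\1_(cylinder (sy y) n.+1) w : R) =
      (\1_(cylinder s n) w * (X n.+1 w == y)%:R)%R.
    rewrite !indicE -natrM mulnb; congr (nat_of_bool _)%:R.
    apply/idP/andP => [/set_mem ws|[/set_mem ws /eqP Xy]].
      split; last by rewrite (ws n.+1)// /sy eqxx.
      by rewrite -(syn y); apply/mem_set => i ile; rewrite ws// leqW.
    apply/mem_set => i; rewrite leq_eqVlt => /predU1P[->|]; first by rewrite /sy eqxx.
    by rewrite -(syn y) in ws => /ws.
  rewrite (eq_bigr (fun y => (X n.+1 w == y)%:R *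
      (\1_(cylinder s n) w * (r (s n) y * path_weight rs n.+1 w)))%R); last first.
    by move=> y _; rewrite ind; ring.
  rewrite sum_fset_delta /= indicE.
  have [/set_mem /(_ n (leqnn n)) <-|_] := boolP (w \in cylinder s n).
    by rewrite !mul1r mulrA.
  by rewrite !mul0r mulr0.
have int y : (Pr x).-integrable setT (fun w => (r (s n) y)%:E *
    (\1_(cylinder (sy y) n.+1) w * path_weight rs n.+1 w)%:E).
  by apply: integrableZl => //; exact: (IHrs _ _).1.
split; first by under eq_fun do rewrite E; exact: integrable_sum.
under eq_integral do rewrite E.
rewrite integral_sum//=.
have cfin : Pr x (cylinder s n) \is a fin_num.
  by apply: fin_num_measure; exact: measurable_cylinder.
rewrite -(fineK cfin) -EFinM mulr_sumr -sumEFin; apply: eq_bigr => y _.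
have [intf intE] := IHrs (sy y) n.+1.
rewrite integralZl// intE /cylinder step -!/(cylinder _ _) syn -(fineK cfin).
rewrite /sy eqxx ltn_eqF// -!EFinM; congr EFin; ring.
Qed.

End path.
End markov.

(** * Path values as matrix products and the limits of their sums *)

Section path_matrix.
Local Open Scope ring_scope.
Context (R : realType) (S : countType) (K : {fset S}) (f : S -> R).
Variable P : S -> S -> R.
Let F := restr_col f K.
Let B := block P K.

Definition path_col (Ms : seq (S -> S -> R)) : 'cV[R]_#|{: K}| :=
  \col_i path_value K f Ms (fset_elt i).

Lemma path_value_cons M Ms x :
  path_value K f (M :: Ms) x = (entry_row M x K *m path_col Ms) 0 0.
Proof. by rewrite mxE/= sum_fset_elt; apply: eq_bigr => i _; rewrite !mxE. Qed.

Arguments path_value : simpl never.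

Lemma path_col_cons M Ms : path_col (M :: Ms) = block M K *m path_col Ms.
Proof.
apply/colP => i; rewrite mxE path_value_cons !mxE.
by apply: eq_bigr => j _; rewrite !mxE.
Qed.

Lemma path_col_nseq k Ms : path_col (nseq k P ++ Ms) = B ^+ k *m path_col Ms.
Proof.
elim: k => [|k IHk]; first by rewrite expr0 mul1mx.
by rewrite [nseq _ _ ++ _]/= path_col_cons IHk mulmxA [B ^+ k.+1]exprS.
Qed.

Lemma path_col0 : path_col [::] = F.
Proof. by apply/colP => i; rewrite !mxE. Qed.

Section limits.
Variable z : S.
Hypothesis P_stoch : stochastic P.
Hypothesis zK : z \notin K.
Hypothesis reach : forall x, exists n (s : nat -> S), [/\ s 0%N = x, s n = z
  & forall i, (i < n)%N -> 0 < P (s i) (s i.+1)].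
Let N := potential P K.
Let Bge := @block_ge0 _ _ _ P_stoch K.
Let Ble := @block_row_le1 _ _ _ P_stoch K.
Let Bunit : 1%:M - B \in unitmx := block_unitmx P_stoch zK reach.

Lemma cvg_path_value :
  \sum_(j < n) path_value K f (nseq j P) z @[n --> \oo] -->
  f z + (entry_row P z K *m N *m F) 0 0.
Proof.
(* The term [j = 0] is [f z]; in the others the first step leaves [z] through [entry_row], so only
   [j - 1] powers of the block remain. *)
have E n : \sum_(j < n.+1) path_value K f (nseq j P) z =
    f z + (entry_row P z K *m (\sum_(j < n) B ^+ j) *m F) 0 0.
  rewrite big_ord_recl; congr (_ + _).
  rewrite mulmx_sumr mulmx_suml summxE; apply: eq_bigr => j _.
  by rewrite lift0 [nseq _.+1 _]/= path_value_cons
    -[nseq j P]cats0 path_col_nseq path_col0 mulmxA.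
rewrite -cvg_shiftS (funext E).
apply: cvgD; first exact: cvg_cst.
apply: (@cvg_mxM _ _ _ _ _ _ (fun=> F)) => [i k|i k]; last exact: cvg_cst.
apply: (@cvg_mxM _ _ _ _ (fun=> entry_row P z K)) => [i' k'|i' k']; first exact: cvg_cst.
rewrite (funext (fun n => summxE _ _ _ i' k')); exact: mxgeom_cvg.
Qed.

Variable P' : S -> S -> R.

(** The index [k] marks the step that uses [P']. For [k = 0] it is the step out of [z], which leaves
    one Neumann series; for [k > 0] it lies inside [K], between two Neumann series. *)
Lemma cvg_path_deriv :
  \sum_(j < n) \sum_(k < j)
    path_value K f (nseq k P ++ P' :: nseq (j - k.+1) P) z @[n --> \oo] -->
  (entry_row P' z K *m N *m F
   + entry_row P z K *m N *m block P' K *m N *m F) 0 0.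
Proof.
have V k l : path_col (nseq k P ++ P' :: nseq l P) = B ^+ k *m block P' K *m B ^+ l *m F.
  by rewrite path_col_nseq path_col_cons -[nseq l P]cats0 path_col_nseq path_col0 !mulmxA.
(* The case [k = 0] needs [j >= 1] and the case [k > 0] needs [j >= 2], hence the different lengths
   [n.+1] and [n] on the right. *)
have E n : \sum_(j < n.+2) \sum_(k < j)
      path_value K f (nseq k P ++ P' :: nseq (j - k.+1) P) z =
    (entry_row P' z K *m (\sum_(j < n.+1) B ^+ j) *m F) 0 0 +
    (entry_row P z K *m
     (\sum_(j < n) \sum_(k < j.+1) B ^+ k *m block P' K *m B ^+ (j - k)) *m F) 0 0.
  rewrite big_ord_recl big_ord0 add0r.
  under eq_bigr do rewrite big_ord_recl.
  rewrite big_split/=; congr (_ + _).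
    rewrite mulmx_sumr mulmx_suml summxE; apply: eq_bigr => j _.
    by rewrite path_value_cons -[nseq _ P]cats0 path_col_nseq path_col0 mulmxA
      /bump leq0n add1n subn1.
  rewrite big_ord_recl big_ord0 add0r.
  rewrite mulmx_sumr mulmx_suml summxE; apply: eq_bigr => j _.
  rewrite mulmx_sumr mulmx_suml summxE; apply: eq_bigr => k _.
  by rewrite path_value_cons V /bump !leq0n !add1n subSS !mulmxA.
rewrite -cvg_shiftS -cvg_shiftS (funext E) mxE.
apply: cvgD.
  apply: (@cvg_mxM _ _ _ _ _ _ (fun=> F)) => [i k|i k]; last exact: cvg_cst.
  apply: (@cvg_mxM _ _ _ _ (fun=> entry_row P' z K)) => [i' k'|i' k'].
    exact: cvg_cst.
  rewrite (funext (fun n => summxE _ _ _ i' k')).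
  rewrite (cvg_shiftS (fun n => \sum_(j < n) (B ^+ j) i' k')); exact: mxgeom_cvg.
have -> : entry_row P z K *m N *m block P' K *m N *m F =
    entry_row P z K *m (N *m block P' K *m N) *m F by rewrite !mulmxA.
apply: (@cvg_mxM _ _ _ _ _ _ (fun=> F)) => [i k|i k]; last exact: cvg_cst.
apply: (@cvg_mxM _ _ _ _ (fun=> entry_row P z K)) => [i' k'|i' k']; first exact: cvg_cst.
have E2 n : (\sum_(j < n) \sum_(k < j.+1) B ^+ k *m block P' K *m B ^+ (j - k)) i' k' =
  \sum_(j < n) \sum_(k < j.+1) (B ^+ k *m block P' K *m B ^+ (j - k)) i' k'.
  by rewrite summxE; apply: eq_bigr => j _; rewrite summxE.
rewrite (funext E2); exact: mxcauchy_cvg.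
Qed.

End limits.
End path_matrix.

(** The point [a] is a local minimum: left difference quotients are nonpositive, right ones
    nonnegative. It serves for transition probabilities that vanish at [theta0]. *)
Lemma derive1_eq0_ge0 (R : realType) (g : R -> R) (a : R) : derivable g a 1%R ->
  g a = 0%R -> (\forall t \near a, (0 <= g t)%R) -> derive1 g a = 0%R.
Proof.
move=> dg ga0; rewrite (near_shift 0%R) subr0 => g0.
have q_cvg : (h^-1 * g (h + a))%R @[h --> 0%R^'] --> derive1 g a.
  have := dg; rewrite derive1E => /cvg_ex[l gl].
  rewrite /derive (cvg_lim _ gl)//; apply: cvg_trans gl; apply: near_eq_cvg.
  by apply: nearW => h; rewrite ga0 subr0 /= [(_ *: 1)%R]mulr1.
apply/eqP; rewrite eq_le; apply/andP; split.
  apply: cvgr_to_le (cvg_dnbhs_at_left q_cvg) _; near=> h.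
  apply: mulr_le0_ge0; first by
    rewrite invr_le0; apply: ltW; near: h; exact: nbhs_left_lt.
  by near: h; apply: cvg_within; exact: g0.
apply: cvgr_to_ge (cvg_dnbhs_at_right q_cvg) _; near=> h.
apply: mulr_ge0; first by rewrite invr_ge0; apply: ltW; near: h; exact: nbhs_right_gt.
by near: h; apply: cvg_within; exact: g0.
Unshelve. all: by end_near. Qed.

(** * Cycles truncated at the exit from a finite set *)

Section truncated_cycle.
Context (R : realType) (S : countType) (d : measure_display)
        (Omega : measurableType d) (X : nat -> Omega -> S).
Variables (P : S -> S -> R) (Pr : S -> probability Omega R) (z : S).
Hypothesis X_markov : markov_chain X P Pr.
Hypothesis X_rec : recurrent X Pr.

Let tau := return_time R X z.
Definition trunc_time (A : {fset S}) (w : Omega) : \bar R :=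
  mine (return_time R X z w) (exit_time R X A w).

Lemma measurable_lt_return (j : nat) :
  measurable_fun setT (fun w => j%:R%:E < tau w).
Proof.
apply: (@measurable_lt_first_time R _ _ (fun n w => (1 <= n)%N /\ X n w = z)) => n.
case: n => [|n].
  by rewrite (_ : [set w | _] = set0)//; apply/seteqP; split => // w [].
rewrite (_ : [set w | _] = [set w | X n.+1 w = z]).
  exact: (measurable_state X_markov).
by apply/seteqP; split => w //= [].
Qed.

Lemma measurable_lt_exit (A : {fset S}) (j : nat) :
  measurable_fun setT (fun w => j%:R%:E < exit_time R X A w : bool).
Proof.
apply: (@measurable_lt_first_time R _ _ (fun n w => X n w \notin A)) => n.
have := @measurable_state_comp _ _ _ _ _ _ _ X_markov _ _ (fun x => x \notin A) n.
by move=> /(_ measurableT [set true] I); rewrite setTI.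
Qed.

Lemma measurable_lt_trunc (A : {fset S}) (j : nat) :
  measurable_fun setT (fun w => j%:R%:E < trunc_time A w).
Proof.
rewrite /trunc_time; under eq_fun do rewrite lt_min.
by apply: measurable_and; [exact: measurable_lt_return|exact: measurable_lt_exit].
Qed.

Lemma ae_return_lty : \forall w \ae Pr z, tau w < +oo.
Proof.
apply: (@ae_probability1 _ _ _ _ [set w | tau w < +oo]); last exact: X_rec.
rewrite (_ : [set w | _] = \bigcup_n ~` [set w | n%:R%:E < tau w]).
  apply: bigcup_measurable => n _; apply: measurableC.
  have := measurable_lt_return n.
  by move=> /(_ measurableT [set true] I); rewrite setTI.
apply/seteqP; split => w /=.
  by move=> /lty_le_nat[m tm]; exists m => //=; apply/negP; rewrite -leNgt.
by move=> [n _ /= /negP]; rewrite -leNgt => /le_lt_trans; apply; exact: ltry.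
Qed.

(** Turns the stopping condition into the indicator inside [path_weight]. Time 0 imposes nothing:
    the start [z] lies in [A], and returns count only from time 1. *)
Lemma lt_trunc_time (A : {fset S}) w (j : nat) : z \in A -> X 0%N w = z ->
  (j%:R%:E < trunc_time A w) = all (fun i => X i w \in (A `\ z)%fset) (iota 1 j).
Proof.
move=> zA Xz; rewrite lt_min; apply/andP/allP.
  move=> [/lt_first_time jz /lt_first_time jA] i; rewrite mem_iota => /andP[i1 ij].
  rewrite !inE; apply/andP; split.
    by apply/eqP => Xiz; have := jz i (conj i1 Xiz); lia.
  by apply: contraT => XiA; have := jA i XiA; lia.
move=> jK; split; apply/lt_first_time => n.
  move=> [n1 Xnz]; rewrite ltnNge; apply/negP => nj.
  have /jK : n \in iota 1 j by rewrite mem_iota; lia.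
  by rewrite !inE Xnz eqxx.
move=> XnA; rewrite ltnNge; apply/negP => nj; case: n XnA nj => [|n] XnA nj.
  by move: XnA; rewrite /= Xz zA.
have /jK : n.+1 \in iota 1 j by rewrite mem_iota; lia.
by rewrite !inE (negbTE XnA) andbF.
Qed.

(** Up to a time [m] beyond the return, the trajectory visits finitely many states; some [A k0]
    contains them all, so the exit happens after [m]. *)
Lemma near_trunc_time (A : nat -> {fset S}) :
  (forall n, (A n `<=` A n.+1)%fset) -> \bigcup_n [set` A n] = [set: S] ->
  forall w, tau w < +oo -> \forall k \near \oo, trunc_time (A k) w = tau w.
Proof.
move=> A_mono A_cover w /lty_le_nat[m tm].
have A_le k l x : (k <= l)%N -> x \in A k -> x \in A l.
  move=> kl; elim: l kl => [|l IHl]; first by rewrite leqn0 => /eqP ->.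
  rewrite leq_eqVlt => /predU1P[<-//|/IHl kl /kl]; exact/fsubsetP.
have [k0 Ak0] : exists k0, forall i, (i <= m)%N -> X i w \in A k0.
  elim: m {tm} => [|m [k IHm]].
    have : [set: S] (X 0%N w) by [].
    rewrite -A_cover => -[k _ /= Ak]; exists k => i; rewrite leqn0 => /eqP ->//.
  have : [set: S] (X m.+1 w) by [].
  rewrite -A_cover => -[l _ /= Al]; exists (maxn k l) => i.
  rewrite leq_eqVlt => /predU1P[->|im]; first exact: (A_le _ _ _ (leq_maxr _ _) Al).
  by apply: (A_le _ _ _ (leq_maxl _ _)); exact: IHm.
exists k0 => // k /= k0k; rewrite /trunc_time min_l//.
apply: le_trans tm _; apply/ltW/lt_first_time => n.
move=> XnA; rewrite ltnNge; apply/negP => nm; move: XnA => /=.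
by rewrite (A_le _ _ _ k0k (Ak0 n nm)).
Qed.

(** [L j] lists the sequences of step weights whose path weights add up to the stopped term [j]: a
    single sequence for the value, one per marked step for the derivative. *)
Lemma integral_stopped_psum (t : Omega -> \bar R) (u : nat -> Omega -> R)
    (K : {fset S}) (g : S -> R) (L : nat -> seq (seq (S -> S -> R))) (N : nat) :
  (forall j : nat, measurable_fun setT (fun w => j%:R%:E < t w)) ->
  (forall j, measurable_fun setT (u j)) ->
  (forall w j, X 0%N w = z -> (if j%:R%:E < t w then u j w else 0%R) =
    (\sum_(rs <- L j) path_weight X K g rs 0 w)%R) ->
  \int[Pr z]_w (\sum_(0 <= j < N | (j%:R%:E < t w)%E) (u j w)%:E) =
  (\sum_(j < N) \sum_(rs <- L j)
     path_value K g [seq (fun x y => P x y * r x y)%R | r <- rs] z)%:E.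
Proof.
(* The cylinder of [s] at time 0 is the event [X 0 = z], of probability one, so its indicator can be
   inserted under the integral. *)
move=> mt mu uL; pose s := cst z : nat -> S.
pose h rs w := (\1_(cylinder X s 0) w * path_weight X K g rs 0 w)%:E.
have h_int rs := integral_path_cylinder X_markov K g z rs s 0.
have ih rs : (Pr z).-integrable setT (h rs) by exact: (h_int rs).1.
have ihL j : (Pr z).-integrable setT (fun w => \sum_(rs <- L j) h rs w).
  exact: integrable_sum.
rewrite (ae_eq_integral (fun w => \sum_(j < N) \sum_(rs <- L j) h rs w))//; last 3 first.
- exact: measurable_stopped_psum.
- apply: (@measurable_int _ _ _ (Pr z)); apply: integrable_sum => //.
- apply: filterS (ae_start X_markov z) => w Xz _.
  rewrite big_mkcond big_mkord; apply: eq_bigr => j _;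
  rewrite -(fun_if EFin) uL// -sumEFin; apply: eq_bigr => rs _.
  rewrite /h indicE mem_set ?mul1r//.
  by move=> i; rewrite leqn0 => /eqP ->.
rewrite integral_sum// -sumEFin; apply: eq_bigr => j _.
rewrite integral_sum// -sumEFin; apply: eq_bigr => rs _.
rewrite (h_int rs).2 [X in X * _](_ : _ = 1) ?mul1e//.
have [_ start _] := X_markov; rewrite -(start z); congr (Pr z _).
by apply/seteqP; split => [w /(_ 0%N isT)//|w /= Xz i]; rewrite leqn0 => /eqP ->.
Qed.

(** The limiting argument shared by the value and the derivative: [V B] is the matrix expression for
    the set [B], and [p B N] the path sum over times below [N]. *)
Lemma cvg_trunc_integral (u : nat -> Omega -> R) (A : nat -> {fset S}) (V : {fset S} -> R)
    (p : {fset S} -> nat -> R) :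
  (forall n, (A n `<=` A n.+1)%fset) -> \bigcup_n [set` A n] = [set: S] ->
  (forall n, z \in A n) ->
  (forall j, measurable_fun setT (u j)) ->
  \int[Pr z]_w stopped_sum (tau w) (fun j => `|u j w|%R) < +oo ->
  (forall B N, z \in B -> \int[Pr z]_w (\sum_(0 <= j < N | (j%:R%:E < trunc_time B w)%E)
    (u j w)%:E) = (p B N)%:E) ->
  (forall B, z \in B -> p B N @[N --> \oo] --> V B) ->
  (\int[Pr z]_w stopped_sum (trunc_time (A n) w) (u ^~ w) @[n --> \oo] -->
    \int[Pr z]_w stopped_sum (tau w) (u ^~ w)) /\
  ((V (A n))%:E @[n --> \oo] --> \int[Pr z]_w stopped_sum (tau w) (u ^~ w)).
Proof.
move=> A_mono A_cover zA mu dom pE pV.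
have t_le B w : trunc_time B w <= tau w by rewrite ge_min lexx.
have main := cvg_integral_stopped_sum measurable_lt_return mu ae_return_lty dom
  (fun k => measurable_lt_trunc (A k)) (fun k => t_le (A k))
  (near_trunc_time A_mono A_cover).
split; first exact: main.
(* Both sides are limits of [p (A n) N] in [N], hence equal by uniqueness. *)
suff VE n : \int[Pr z]_w stopped_sum (trunc_time (A n) w) (u ^~ w) = (V (A n))%:E.
  by rewrite -(funext VE).
have := cvg_integral_stopped_psum measurable_lt_return mu ae_return_lty dom
  (measurable_lt_trunc (A n)) (t_le (A n)).
rewrite (funext (fun N => pE _ N (zA n))) => /cvg_unique; apply => //.
by apply: cvg_EFin; [exact: nearW|exact: pV].
Qed.

End truncated_cycle.

(** * Path weights of the two kinds of summands *)

Section truncation_terms.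
Local Open Scope ring_scope.
Context (R : realType) (S : countType) (d : measure_display)
        (Omega : measurableType d) (X : nat -> Omega -> S).
Variables (K : {fset S}) (f : S -> R).

Lemma path_weight_const w j :
  path_weight X K f (nseq j (fun _ _ => 1)) 0 w =
  (all (fun i => X i w \in K) (iota 1 j))%:R * f (X j w).
Proof.
rewrite path_weightE size_nseq big1 ?mulr1// => i _.
by rewrite nth_nseq; case: ifP.
Qed.

Lemma path_weight_mark w j k (r : S -> S -> R) : (k < j)%N ->
  path_weight X K f (nseq k (fun _ _ => 1) ++ r :: nseq (j - k.+1) (fun _ _ => 1)) 0 w =
  (all (fun i => X i w \in K) (iota 1 j))%:R * r (X k w) (X k.+1 w) * f (X j w).
Proof.
move=> kj; rewrite path_weightE size_cat /= !size_nseq.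
have -> : (k + (j - k.+1).+1 = j)%N by lia.
rewrite (bigD1 (Ordinal kj))//= nth_cat size_nseq ltnn subnn/= big1 ?mulr1//.
move=> i ik; rewrite nth_cat size_nseq nth_nseq.
case: ltnP => // ki; have -> : (i - k = (i - k.+1).+1)%N.
  by move: ik; rewrite -val_eqE/=; lia.
by rewrite /= nth_nseq; case: ifP.
Qed.

End truncation_terms.

(** * Convergence of the truncation approximations *)

Unset Implicit Arguments.
Set Strict Implicit.
Set Printing Implicit Defensive.

Theorem proposition1 (R : realType) (S : countType)
  (Theta : set R) (P : R -> S -> S -> R)
  (d : measure_display) (Omega : measurableType d) (X : nat -> Omega -> S)
  (Pr : R -> S -> probability Omega R)
  (theta0 : R) (z : S) (f : S -> R) (A : nat -> {fset S})
  (Theta_open : open Theta) (Theta_itv : is_interval Theta)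
  (P_stoch : forall t, Theta t -> stochastic (P t))
  (X_markov : forall t, Theta t -> markov_chain X (P t) (Pr t))
  (X_irr : forall t, Theta t -> irreducible X (Pr t))
  (X_rec : forall t, Theta t -> recurrent X (Pr t))
  (theta0_in : Theta theta0)
  (P_diff : forall x y, derivable (fun t : R => P t x y) theta0 1%R)
  (A_mono : forall n, (A n `<=` A n.+1)%fset)
  (zA : z \in A 0%N)
  (A_cover : \bigcup_n [set` A n] = [set: S]) :
  let P0 := P theta0 in
  let P0' := fun x y => derive1 (fun t : R => P t x y) theta0 in
  let w := fun (t : R) (g : S -> R) => cycle_value X (Pr t) z g in
  let abs_f := fun x => `|f x|%R in
  let abs_P0' := fun x y => `|P0' x y|%R in
  (w theta0 abs_f < +oo ->
     trunc_value X (Pr theta0) (A n) z f @[n --> \oo] --> w theta0 f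
     /\ (trunc_value_mx P0 (A n) z f)%:E @[n --> \oo] --> w theta0 f)
  /\
  ((\forall t \near theta0, w t f \is a fin_num) ->
   derivable (fun t : R => fine (w t f)) theta0 1%R ->
   (derive1 (fun t : R => fine (w t f)) theta0)%:E
     = cycle_weighted X (Pr theta0) P0 P0' z f ->
   cycle_weighted X (Pr theta0) P0 abs_P0' z abs_f < +oo ->
   trunc_deriv_mx P0 P0' (A n) z f @[n --> \oo]
     --> derive1 (fun t : R => fine (w t f)) theta0).
Proof.
have stoch := P_stoch _ theta0_in.
have markov := X_markov _ theta0_in.
have reach := irreducible_path stoch markov (X_irr _ theta0_in).
have rec := X_rec _ theta0_in.
have zAn n : z \in A n.
  by elim: n => [//|n]; exact/fsubsetP.
have zK (B : {fset S}) : z \notin (B `\ z)%fset by rewrite !inE eqxx.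
move=> P0 P0' w abs_f abs_P0'; split=> [w_fin|_ _ w'E w_fin].
  (* For the value all step weights are 1, so the path sums involve [P0] alone. *)
  apply: (@cvg_trunc_integral _ _ _ _ _ _ _ _ markov rec (fun j v => f (X j v)) A
    (fun B => trunc_value_mx P0 B z f)
    (fun B N => \sum_(j < N) path_value (B `\ z)%fset f (nseq j P0) z)%R).
  - exact: A_mono.
  - exact: A_cover.
  - exact: zAn.
  - by move=> j; exact: (measurable_state_comp markov).
  - exact: w_fin.
  - move=> B N zB; rewrite (@integral_stopped_psum _ _ _ _ _ _ _ _ markov
      _ _ (B `\ z)%fset f (fun j => [:: nseq j (fun _ _ => 1%R)])).
    + congr EFin; apply: eq_bigr => j _; rewrite big_seq1 map_nseq.
      congr (path_value _ _ (nseq _ _) _).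
      by apply/funext => x; apply/funext => y; rewrite mulr1.
    + exact: (measurable_lt_trunc z markov).
    + by move=> j; exact: (measurable_state_comp markov).
    + move=> v j Xz; rewrite big_seq1 path_weight_const (lt_trunc_time R j zB Xz).
      by case: ifP => _; rewrite ?mul1r ?mul0r.
  - by move=> B zB; exact: cvg_path_value.
(* Since [Theta] is open, the entry stays nonnegative for all parameters near [theta0]. *)
have P0'0 x y : P0 x y = 0%R -> P0' x y = 0%R.
  move=> Pxy; apply: derive1_eq0_ge0 => //.
  by apply: filterS (open_nbhs_nbhs (conj Theta_open theta0_in)) => t /P_stoch[].
pose r x y := (P0' x y / P0 x y)%R.
have Pr' x y : (P0 x y * r x y = P0' x y)%R.
  rewrite /r; have [P00|Pn0] := eqVneq (P0 x y) 0%R; first by rewrite P00 mul0r P0'0.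
  by rewrite mulrCA divff// mulr1.
pose u j v := (f (X j v) * \sum_(k < j) r (X k v) (X k.+1 v))%R.
have mu j : measurable_fun setT (u j).
  apply: measurable_funM; first exact: (measurable_state_comp markov).
  by apply: measurable_sum => k; exact: (measurable_step_comp markov).
(* The triangle inequality bounds the terms by those of the assumed finite expectation, where [P0]
   needs no absolute value. *)
have dom : \int[Pr theta0 z]_v
    stopped_sum (return_time R X z v) (fun j => `|u j v|%R) < +oo.
  apply: le_lt_trans w_fin; apply: ge0_le_integral => //.
  - by move=> v _; exact: nneseries_ge0.
  - apply: measurable_stopped_sum => j; first exact: (measurable_lt_return z markov).
    exact: measurableT_comp.
  - apply: measurable_stopped_sum => j; first exact: (measurable_lt_return z markov).
    apply: measurable_funM; first exact: (measurable_state_comp markov).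
    apply: measurable_sum => k.
    exact: (measurable_step_comp markov (fun x y => abs_P0' x y / P0 x y)%R).
  - move=> v _; apply: lee_nneseries => [j _ _|j _]; rewrite lee_fin ?normr_ge0//.
    rewrite normrM ler_wpM2l// (le_trans (ler_norm_sum _ _ _))// ler_sum// => k _.
    by rewrite normrM normfV (ger0_norm (stoch.1 _ _)).
have [||_] := @cvg_trunc_integral _ _ _ _ _ _ _ _ markov rec u A
    (fun B => trunc_deriv_mx P0 P0' B z f)
    (fun B N => \sum_(j < N) \sum_(k < j)
      path_value (B `\ z)%fset f (nseq k P0 ++ P0' :: nseq (j - k.+1) P0) z)%R
    A_mono A_cover zAn mu dom.
(* The sequence for [k] carries the ratio [r] at step [k] and 1 elsewhere; multiplication by [P0]
   turns [r] into [P0']. *)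
- move=> B N zB; pose L (j : nat) :=
    [seq nseq k (fun _ _ => 1%R) ++ r :: nseq (j - k.+1) (fun _ _ => 1%R) | k : 'I_j <- index_enum 'I_j].
  rewrite (@integral_stopped_psum _ _ _ _ _ _ _ _ markov _ _ (B `\ z)%fset f L)//.
  + congr EFin; apply: eq_bigr => j _; rewrite big_map; apply: eq_bigr => k _.
    rewrite map_cat /= !map_nseq; congr (path_value _ _ (nseq _ _ ++ _ :: nseq _ _) _);
    by apply/funext => x; apply/funext => y; rewrite ?mulr1// Pr'.
  + exact: (measurable_lt_trunc z markov).
  + move=> v j Xz; rewrite big_map (lt_trunc_time R j zB Xz) /u mulr_sumr.
    case: ifPn => [jK|/negbTE jK].
      by apply: eq_bigr => k _; rewrite path_weight_mark// jK mul1r mulrC.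
    by rewrite big1// => k _; rewrite path_weight_mark// jK !mul0r.
- by move=> B zB; exact: cvg_path_deriv.
(* By [w'E] the limit is a real number, so convergence in the extended reals descends to the
   reals. *)
rewrite -[X in _ --> X]w'E => /fine_cvgP[_]; exact.
Qed.
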